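(* Let $(\mathcal T,\eta,\mu,\tau)$ be a strong monad on $\mathbf{Set}$ (with its cartesian monoidal structure), with right strength $\tau'$. For each set $X$ let $$\mathcal Z X=\{t\in\mathcal T X\mid \forall \text{ sets }Y,\ \forall s\in\mathcal T Y,\ \mu(\mathcal T\tau'(\tau(t,s)))=\mu(\mathcal T\tau(\tau'(t,s)))\}$$ and let $\iota_X:\mathcal Z X\subseteq\mathcal T X$ be the inclusion. Then the assignment $\mathcal Z(-)$ extends to a commutative submonad $(\mathcal Z,\eta^{\mathcal Z},\mu^{\mathcal Z},\tau^{\mathcal Z})$ of $\mathcal T$ with the inclusions $\iota_X$ forming the submonad morphism $\iota:\mathcal Z\Rightarrow\mathcal T$. Furthermore, the canonical embedding functor $\mathcal I:\mathbf{Set}_{\mathcal Z}\to\mathbf{Set}_{\mathcal T}$ corestricts to an isomorphism of categories $\mathbf{Set}_{\mathcal Z}\cong Z(\mathbf{Set}_{\mathcal T})$.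
   Context: A strong monad $(\mathcal T,\eta,\mu,\tau)$ on a symmetric monoidal category $(\mathcal C,\otimes,I,\gamma)$ has left strength $\tau_{X,Y}:X\otimes\mathcal TY\to\mathcal T(X\otimes Y)$; its right strength is $\tau'_{X,Y}=\mathcal T(\gamma_{Y,X})\circ\tau_{Y,X}\circ\gamma_{\mathcal TX,Y}:\mathcal TX\otimes Y\to\mathcal T(X\otimes Y)$. It is commutative if $\mu\circ\mathcal T\tau'\circ\tau=\mu\circ\mathcal T\tau\circ\tau':\mathcal TX\otimes\mathcal TY\to\mathcal T(X\otimes Y)$ for all $X,Y$. A morphism of strong monads $\iota:\mathcal S\Rightarrow\mathcal T$ is a natural transformation with $\iota\circ\eta^{\mathcal S}=\eta^{\mathcal T}$, $\iota\circ\mu^{\mathcal S}=\mu^{\mathcal T}\circ\mathcal T\iota\circ\iota_{\mathcal S}$ and $\iota\circ\tau^{\mathcal S}_{X,Y}=\tau^{\mathcal T}_{X,Y}\circ(X\otimes\iota_Y)$; a (strong) submonad of $\mathcal T$ is a strong monad $\mathcal S$ with such an $\iota$ that is a monomorphism in the category of strong monads on $\mathcal C$; it is a commutative submonad if $\mathcal S$ is commutative. The Kleisli category $\mathcal C_{\mathcal T}$ has morphisms $X\to\mathcal TY$, composition $g\odot f=\mu\circ\mathcal Tg\circ f$, identities $\eta$. For a submonad $\iota:\mathcal S\Rightarrow\mathcal T$, the canonical embedding $\mathcal I:\mathcal C_{\mathcal S}\to\mathcal C_{\mathcal T}$ is the identity on objects and sends $f:X\to\mathcal SY$ to $\iota_Y\circ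 f$. For $f:Y\to\mathcal TZ$ define $f\otimes_l X=\tau'_{Z,X}\circ(f\otimes X)$ and $X\otimes_r f=\tau_{X,Z}\circ(X\otimes f)$. A Kleisli morphism $f:X\to\mathcal TY$ is central if for every $f':X'\to\mathcal TY'$, $(f\otimes_l Y')\odot(X\otimes_r f')=(Y\otimes_r f')\odot(f\otimes_l X')$. The premonoidal centre $Z(\mathcal C_{\mathcal T})$ is the subcategory of $\mathcal C_{\mathcal T}$ with all objects and the central morphisms. *)

(* Defs.v *)
From Stdlib Require Import FunctionalExtensionality ProofIrrelevance.

Set Implicit Arguments.
Unset Strict Implicit.
Unset Printing Implicit Defensive.

Declare Scope cat_scope.
Delimit Scope cat_scope with cat.
Open Scope cat_scope.

Reserved Notation "g ∘ f" (at level 40, left associativity).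
Reserved Notation "X ⊗ Y" (at level 35, right associativity).
Reserved Notation "f ⊠ g" (at level 35, right associativity).

Record Category := {
  Ob :> Type;
  Hom : Ob -> Ob -> Type;
  idm : forall X, Hom X X;
  comp : forall X Y Z, Hom Y Z -> Hom X Y -> Hom X Z;
  comp_idl : forall X Y (f : Hom X Y), comp (idm Y) f = f;
  comp_idr : forall X Y (f : Hom X Y), comp f (idm X) = f;
  comp_assoc : forall W X Y Z (h : Hom Y Z) (g : Hom X Y) (f : Hom W X),
    comp h (comp g f) = comp (comp h g) f
}.

Arguments Hom {c} _ _.
Arguments idm {c} _.
Arguments comp {c X Y Z} _ _.

Notation "g ∘ f" := (comp g f) : cat_scope.

Definition monomorphism (C : Category) (X Y : C) (m : Hom X Y) : Prop :=
  forall (W : C) (f g : Hom W X), m ∘ f = m ∘ g -> f = g.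

Record Functor (C D : Category) := {
  fob :> C -> D;
  fhom : forall X Y, Hom X Y -> Hom (fob X) (fob Y);
  fhom_id : forall X, fhom (idm X) = idm (fob X);
  fhom_comp : forall X Y Z (g : Hom Y Z) (f : Hom X Y),
    fhom (g ∘ f) = fhom g ∘ fhom f
}.

Arguments fhom {C D} _ {X Y} _.

Definition functor_id (C : Category) : Functor C C :=
  {| fob := fun X => X;
     fhom := fun X Y f => f;
     fhom_id := fun X => eq_refl;
     fhom_comp := fun X Y Z g f => eq_refl |}.

Definition functor_comp (C D E : Category) (G : Functor D E) (F : Functor C D)
  : Functor C E.
Proof.
refine {| fob := fun X => G (F X); fhom := fun X Y f => fhom G (fhom F f) |}.
- intros X; now rewrite !fhom_id.
- intros X Y Z g f; now rewrite !fhom_comp.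
Defined.

(* Strict isomorphism: the two composites are equal to the identities, as
   functors. *)
Definition category_isomorphism (C D : Category) (F : Functor C D) : Prop :=
  exists G : Functor D C,
    functor_comp G F = functor_id C /\ functor_comp F G = functor_id D.

Record SymMonCat := {
  smc_cat :> Category;
  tens : smc_cat -> smc_cat -> smc_cat;
  tens1 : forall X X' Y Y' : smc_cat,
    Hom X X' -> Hom Y Y' -> Hom (tens X Y) (tens X' Y');
  munit : smc_cat;
  assoc : forall X Y Z : smc_cat,
    Hom (tens (tens X Y) Z) (tens X (tens Y Z));
  assoc_inv : forall X Y Z : smc_cat,
    Hom (tens X (tens Y Z)) (tens (tens X Y) Z);
  lunit : forall X : smc_cat, Hom (tens munit X) X;
  lunit_inv : forall X : smc_cat, Hom X (tens munit X);
  runit : forall X : smc_cat, Hom (tens X munit) X;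
  runit_inv : forall X : smc_cat, Hom X (tens X munit);
  braid : forall X Y : smc_cat, Hom (tens X Y) (tens Y X);

  tens1_id : forall X Y : smc_cat,
    tens1 (idm X) (idm Y) = idm (tens X Y);
  tens1_comp : forall (X X' X'' Y Y' Y'' : smc_cat)
      (f' : Hom X' X'') (f : Hom X X') (g' : Hom Y' Y'') (g : Hom Y Y'),
    tens1 (f' ∘ f) (g' ∘ g) = tens1 f' g' ∘ tens1 f g;

  assoc_invl : forall X Y Z, assoc_inv X Y Z ∘ assoc X Y Z = idm _;
  assoc_invr : forall X Y Z, assoc X Y Z ∘ assoc_inv X Y Z = idm _;
  lunit_invl : forall X, lunit_inv X ∘ lunit X = idm _;
  lunit_invr : forall X, lunit X ∘ lunit_inv X = idm _;
  runit_invl : forall X, runit_inv X ∘ runit X = idm _;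
  runit_invr : forall X, runit X ∘ runit_inv X = idm _;

  assoc_nat : forall (X X' Y Y' Z Z' : smc_cat)
      (f : Hom X X') (g : Hom Y Y') (h : Hom Z Z'),
    assoc X' Y' Z' ∘ tens1 (tens1 f g) h = tens1 f (tens1 g h) ∘ assoc X Y Z;
  lunit_nat : forall (X X' : smc_cat) (f : Hom X X'),
    lunit X' ∘ tens1 (idm munit) f = f ∘ lunit X;
  runit_nat : forall (X X' : smc_cat) (f : Hom X X'),
    runit X' ∘ tens1 f (idm munit) = f ∘ runit X;
  braid_nat : forall (X X' Y Y' : smc_cat) (f : Hom X X') (g : Hom Y Y'),
    braid X' Y' ∘ tens1 f g = tens1 g f ∘ braid X Y;

  triangle : forall X Y : smc_cat,
    tens1 (idm X) (lunit Y) ∘ assoc X munit Y = tens1 (runit X) (idm Y);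
  pentagon : forall W X Y Z : smc_cat,
    assoc W X (tens Y Z) ∘ assoc (tens W X) Y Z
    = tens1 (idm W) (assoc X Y Z) ∘ assoc W (tens X Y) Z
        ∘ tens1 (assoc W X Y) (idm Z);
  hexagon : forall X Y Z : smc_cat,
    assoc Y Z X ∘ braid X (tens Y Z) ∘ assoc X Y Z
    = tens1 (idm Y) (braid X Z) ∘ assoc Y X Z ∘ tens1 (braid X Y) (idm Z);
  braid_sym : forall X Y : smc_cat, braid Y X ∘ braid X Y = idm _
}.

Arguments tens {s} _ _.
Arguments tens1 {s X X' Y Y'} _ _.
Arguments munit {s}.
Arguments assoc {s} _ _ _.
Arguments lunit {s} _.
Arguments runit {s} _.
Arguments braid {s} _ _.

Notation "X ⊗ Y" := (tens X Y) : cat_scope.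
Notation "f ⊠ g" := (tens1 f g) : cat_scope.

(* [StrongMonad T] is the type of strong monad structures extending the
   assignment on objects [T]. *)
Record StrongMonad (C : SymMonCat) (T : C -> C) := {
  fmap : forall X Y : C, Hom X Y -> Hom (T X) (T Y);
  eta : forall X : C, Hom X (T X);
  mu : forall X : C, Hom (T (T X)) (T X);
  strength : forall X Y : C, Hom (X ⊗ T Y) (T (X ⊗ Y));

  fmap_id : forall X : C, fmap (idm X) = idm (T X);
  fmap_comp : forall (X Y Z : C) (g : Hom Y Z) (f : Hom X Y),
    fmap (g ∘ f) = fmap g ∘ fmap f;
  eta_nat : forall (X Y : C) (f : Hom X Y), eta Y ∘ f = fmap f ∘ eta X;
  mu_nat : forall (X Y : C) (f : Hom X Y),
    mu Y ∘ fmap (fmap f) = fmap f ∘ mu X;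
  mu_eta : forall X : C, mu X ∘ eta (T X) = idm (T X);
  mu_fmap_eta : forall X : C, mu X ∘ fmap (eta X) = idm (T X);
  mu_mu : forall X : C, mu X ∘ mu (T X) = mu X ∘ fmap (mu X);

  strength_nat : forall (X X' Y Y' : C) (f : Hom X X') (g : Hom Y Y'),
    strength X' Y' ∘ (f ⊠ fmap g) = fmap (f ⊠ g) ∘ strength X Y;
  strength_lunit : forall X : C,
    fmap (lunit X) ∘ strength munit X = lunit (T X);
  strength_assoc : forall X Y Z : C,
    fmap (assoc X Y Z) ∘ strength (X ⊗ Y) Z
    = strength X (Y ⊗ Z) ∘ (idm X ⊠ strength Y Z) ∘ assoc X Y (T Z);
  strength_eta : forall X Y : C,
    strength X Y ∘ (idm X ⊠ eta Y) = eta (X ⊗ Y);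
  strength_mu : forall X Y : C,
    strength X Y ∘ (idm X ⊠ mu Y)
    = mu (X ⊗ Y) ∘ fmap (strength X Y) ∘ strength X (T Y)
}.

Arguments fmap {C T} _ {X Y} _.
Arguments eta {C T} _ _.
Arguments mu {C T} _ _.
Arguments strength {C T} _ _ _.

Definition rstrength (C : SymMonCat) (T : C -> C) (M : StrongMonad T) (X Y : C)
  : Hom (T X ⊗ Y) (T (X ⊗ Y)) :=
  fmap M (braid Y X) ∘ strength M Y X ∘ braid (T X) Y.

Arguments rstrength {C T} _ _ _.

Definition commutative (C : SymMonCat) (T : C -> C) (M : StrongMonad T) : Prop :=
  forall X Y : C,
    mu M (X ⊗ Y) ∘ fmap M (rstrength M X Y) ∘ strength M (T X) Y
    = mu M (X ⊗ Y) ∘ fmap M (strength M X Y) ∘ rstrength M X (T Y).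

Record StrongMonadMor (C : SymMonCat) (S T : C -> C)
    (MS : StrongMonad S) (MT : StrongMonad T) := {
  smm :> forall X : C, Hom (S X) (T X);
  smm_nat : forall (X Y : C) (f : Hom X Y),
    smm Y ∘ fmap MS f = fmap MT f ∘ smm X;
  smm_eta : forall X : C, smm X ∘ eta MS X = eta MT X;
  smm_mu : forall X : C,
    smm X ∘ mu MS X = mu MT X ∘ fmap MT (smm X) ∘ smm (S X);
  smm_strength : forall X Y : C,
    smm (X ⊗ Y) ∘ strength MS X Y = strength MT X Y ∘ (idm X ⊠ smm Y)
}.

Lemma smm_ext (C : SymMonCat) (S T : C -> C)
    (MS : StrongMonad S) (MT : StrongMonad T) (a b : StrongMonadMor MS MT) :
  (forall X, a X = b X) -> a = b.
Proof.
destruct a as [a a1 a2 a3 a4], b as [b b1 b2 b3 b4]; simpl; intros e.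
assert (a = b) as -> by (extensionality X; apply e).
f_equal; apply proof_irrelevance.
Qed.

Definition smm_id (C : SymMonCat) (T : C -> C) (M : StrongMonad T)
  : StrongMonadMor M M.
Proof.
refine {| smm := fun X => idm (T X) |}.
- intros X Y f; now rewrite comp_idl, comp_idr.
- intros X; now rewrite comp_idl.
- intros X; now rewrite fmap_id, comp_idl, !comp_idr.
- intros X Y; now rewrite tens1_id, comp_idl, comp_idr.
Defined.

Definition smm_comp (C : SymMonCat) (R S T : C -> C)
    (MR : StrongMonad R) (MS : StrongMonad S) (MT : StrongMonad T)
    (b : StrongMonadMor MS MT) (a : StrongMonadMor MR MS)
  : StrongMonadMor MR MT.
Proof.
refine {| smm := fun X => b X ∘ a X |}.
- intros X Y f.
  now rewrite <- comp_assoc, smm_nat, comp_assoc, smm_nat, comp_assoc.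
- intros X; now rewrite <- comp_assoc, !smm_eta.
- intros X.
  rewrite <- comp_assoc, smm_mu, !comp_assoc, smm_mu, fmap_comp.
  rewrite <- !comp_assoc; do 2 f_equal.
  rewrite !comp_assoc; f_equal; apply smm_nat.
- intros X Y.
  rewrite <- comp_assoc, smm_strength, comp_assoc, smm_strength.
  now rewrite <- comp_assoc, <- tens1_comp, comp_idl.
Defined.

Definition StrongMonads (C : SymMonCat) : Category.
Proof.
refine {| Ob := { T : C -> C & StrongMonad T };
          Hom := fun S T => StrongMonadMor (projT2 S) (projT2 T);
          idm := fun T => smm_id (projT2 T);
          comp := fun R S T b a => smm_comp b a |}.
- intros; apply smm_ext; intros; apply comp_idl.
- intros; apply smm_ext; intros; apply comp_idr.
- intros; apply smm_ext; intros; apply comp_assoc.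
Defined.

Definition is_submonad (C : SymMonCat) (S T : C -> C)
    (MS : StrongMonad S) (MT : StrongMonad T) (i : StrongMonadMor MS MT) : Prop :=
  @monomorphism (StrongMonads C) (existT _ S MS) (existT _ T MT) i.

Definition kcomp (C : SymMonCat) (T : C -> C) (M : StrongMonad T) (X Y Z : C)
    (g : Hom Y (T Z)) (f : Hom X (T Y)) : Hom X (T Z) :=
  mu M Z ∘ fmap M g ∘ f.

Definition Kleisli (C : SymMonCat) (T : C -> C) (M : StrongMonad T) : Category.
Proof.
refine {| Ob := C; Hom := fun X Y : C => Hom X (T Y);
          idm := eta M; comp := @kcomp C T M |}; unfold kcomp.
- intros X Y f; now rewrite mu_fmap_eta, comp_idl.
- intros X Y f.
  now rewrite <- comp_assoc, <- eta_nat, comp_assoc, mu_eta, comp_idl.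
- intros W X Y Z h g f.
  rewrite !fmap_comp, !comp_assoc, <- mu_mu.
  now rewrite <- (comp_assoc (mu M Z) (mu M (T Z))), mu_nat, !comp_assoc.
Defined.

Definition kleisli_embedding (C : SymMonCat) (S T : C -> C)
    (MS : StrongMonad S) (MT : StrongMonad T) (i : StrongMonadMor MS MT)
  : Functor (Kleisli MS) (Kleisli MT).
Proof.
refine (@Build_Functor (Kleisli MS) (Kleisli MT) (fun X : C => X)
          (fun (X Y : C) (f : Hom X (S Y)) => i Y ∘ f) _ _).
- intros X; apply smm_eta.
- intros X Y Z g f; simpl in *; unfold kcomp.
  rewrite !comp_assoc, smm_mu, fmap_comp.
  rewrite <- !comp_assoc; do 2 f_equal.
  rewrite !comp_assoc; f_equal; apply smm_nat.
Defined.

Definition kwhiskl (C : SymMonCat) (T : C -> C) (M : StrongMonad T)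
    (Y Z : C) (f : Hom Y (T Z)) (X : C) : Hom (Y ⊗ X) (T (Z ⊗ X)) :=
  rstrength M Z X ∘ (f ⊠ idm X).

Definition kwhiskr (C : SymMonCat) (T : C -> C) (M : StrongMonad T)
    (X Y Z : C) (f : Hom Y (T Z)) : Hom (X ⊗ Y) (T (X ⊗ Z)) :=
  strength M X Z ∘ (idm X ⊠ f).

Arguments kwhiskl {C T} M {Y Z} f X.
Arguments kwhiskr {C T} M X {Y Z} f.

Definition central (C : SymMonCat) (T : C -> C) (M : StrongMonad T) (X Y : C)
    (f : Hom X (T Y)) : Prop :=
  forall (X' Y' : C) (f' : Hom X' (T Y')),
    kcomp M (kwhiskl M f Y') (kwhiskr M X f')
    = kcomp M (kwhiskr M Y f') (kwhiskl M f X').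

Lemma kwhiskl_eta (C : SymMonCat) (T : C -> C) (M : StrongMonad T) (X Z : C) :
  kwhiskl M (eta M X) Z = eta M (X ⊗ Z).
Proof.
unfold kwhiskl, rstrength.
rewrite <- !comp_assoc, braid_nat, (comp_assoc (strength M Z X)), strength_eta.
now rewrite eta_nat, comp_assoc, <- fmap_comp, braid_sym, fmap_id, comp_idl.
Qed.

Lemma rstrength_mu (C : SymMonCat) (T : C -> C) (M : StrongMonad T) (X Y : C) :
  rstrength M X Y ∘ (mu M X ⊠ idm Y)
  = mu M (X ⊗ Y) ∘ fmap M (rstrength M X Y) ∘ rstrength M (T X) Y.
Proof.
unfold rstrength.
rewrite <- !comp_assoc, braid_nat, (comp_assoc (strength M Y X)), strength_mu.
rewrite !fmap_comp, !comp_assoc, <- mu_nat.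
f_equal; f_equal.
rewrite <- !comp_assoc; do 3 f_equal.
now rewrite <- fmap_comp, braid_sym, fmap_id, comp_idr.
Qed.

Lemma rstrength_nat (C : SymMonCat) (T : C -> C) (M : StrongMonad T)
    (X X' Y : C) (f : Hom X X') :
  rstrength M X' Y ∘ (fmap M f ⊠ idm Y) = fmap M (f ⊠ idm Y) ∘ rstrength M X Y.
Proof.
unfold rstrength.
rewrite <- !comp_assoc, braid_nat, (comp_assoc (strength M Y X')), strength_nat.
now rewrite !comp_assoc, <- !fmap_comp, braid_nat.
Qed.

Lemma kwhiskl_comp (C : SymMonCat) (T : C -> C) (M : StrongMonad T)
    (X Y Z W : C) (g : Hom Y (T Z)) (f : Hom X (T Y)) :
  kwhiskl M (kcomp M g f) W = kcomp M (kwhiskl M g W) (kwhiskl M f W).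
Proof.
unfold kwhiskl, kcomp.
assert (e : (mu M Z ∘ fmap M g ∘ f) ⊠ idm W
            = (mu M Z ⊠ idm W) ∘ (fmap M g ⊠ idm W) ∘ (f ⊠ idm W))
  by now rewrite <- !tens1_comp, !comp_idl.
rewrite e.
rewrite !comp_assoc, rstrength_mu, fmap_comp.
rewrite <- !comp_assoc; do 2 f_equal.
now rewrite !comp_assoc, rstrength_nat.
Qed.

Lemma central_eta (C : SymMonCat) (T : C -> C) (M : StrongMonad T) (X : C) :
  central M (eta M X).
Proof.
intros X' Y' f'; rewrite !kwhiskl_eta.
exact (eq_trans (comp_idl (c := Kleisli M) (kwhiskr M X f'))
         (eq_sym (comp_idr (c := Kleisli M) (kwhiskr M X f')))).
Qed.

Lemma central_comp (C : SymMonCat) (T : C -> C) (M : StrongMonad T)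
    (X Y Z : C) (g : Hom Y (T Z)) (f : Hom X (T Y)) :
  central M g -> central M f -> central M (kcomp M g f).
Proof.
intros cg cf X' Y' f'; rewrite !kwhiskl_comp.
pose proof (@comp_assoc (Kleisli M)) as A; simpl in A.
now rewrite <- A, cf, A, cg, <- A.
Qed.

Definition premonoidal_centre (C : SymMonCat) (T : C -> C) (M : StrongMonad T)
  : Category.
Proof.
refine {| Ob := C;
          Hom := fun X Y : C => { f : Hom X (T Y) | central M f };
          idm := fun X => exist _ (eta M X) (central_eta M X);
          comp := fun X Y Z g f =>
            exist _ (kcomp M (proj1_sig g) (proj1_sig f))
              (central_comp (proj2_sig g) (proj2_sig f)) |}.
- intros X Y [f cf]; apply subset_eq_compat; exact (comp_idl (c := Kleisli M) f).
- intros X Y [f cf]; apply subset_eq_compat; exact (comp_idr (c := Kleisli M) f).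
- intros W X Y Z [h ch] [g cg] [f cf]; apply subset_eq_compat.
  exact (comp_assoc (c := Kleisli M) h g f).
Defined.

Definition centre_inclusion (C : SymMonCat) (T : C -> C) (M : StrongMonad T)
  : Functor (premonoidal_centre M) (Kleisli M) :=
  @Build_Functor (premonoidal_centre M) (Kleisli M) (fun X : C => X)
    (fun (X Y : C) (f : { f : Hom X (T Y) | central M f }) => proj1_sig f)
    (fun X => eq_refl) (fun X Y Z g f => eq_refl).

(* Sets are the types of one fixed universe; equality of maps is extensional by
   the axiom of functional extensionality. *)
Definition SetCat : Category :=
  {| Ob := Type;
     Hom := fun X Y => X -> Y;
     idm := fun X x => x;
     comp := fun X Y Z g f x => g (f x);
     comp_idl := fun X Y f => eq_refl;
     comp_idr := fun X Y f => eq_refl;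
     comp_assoc := fun W X Y Z h g f => eq_refl |}.

Definition SetSMC : SymMonCat.
Proof.
refine {| smc_cat := SetCat;
  tens := fun X Y : Type => (X * Y)%type;
  tens1 := fun (X X' Y Y' : Type) (f : X -> X') (g : Y -> Y') (p : X * Y) =>
    (f (fst p), g (snd p));
  munit := unit;
  assoc := fun (X Y Z : Type) (p : (X * Y) * Z) =>
    (fst (fst p), (snd (fst p), snd p));
  assoc_inv := fun (X Y Z : Type) (p : X * (Y * Z)) =>
    ((fst p, fst (snd p)), snd (snd p));
  lunit := fun (X : Type) (p : unit * X) => snd p;
  lunit_inv := fun (X : Type) (x : X) => (tt, x);
  runit := fun (X : Type) (p : X * unit) => fst p;
  runit_inv := fun (X : Type) (x : X) => (x, tt);
  braid := fun (X Y : Type) (p : X * Y) => (snd p, fst p) |};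
intros; simpl in *; extensionality p;
repeat match goal with
  | p : (_ * _)%type |- _ => destruct p
  | u : unit |- _ => destruct u
  end; reflexivity.
Defined.

(* The quantification over all sets [Y] occurs inside [Prop], which is
   impredicative, so [ZSet M X] lies in the same universe as [T X]. *)
Definition ZSet (T : SetSMC -> SetSMC) (M : StrongMonad T) (X : SetSMC) : SetSMC :=
  { t : T X | forall (Y : SetSMC) (s : T Y),
      mu M (X ⊗ Y) (fmap M (rstrength M X Y) (strength M (T X) Y (t, s)))
      = mu M (X ⊗ Y) (fmap M (strength M X Y) (rstrength M X (T Y) (t, s))) }.

Definition ZSet_incl (T : SetSMC -> SetSMC) (M : StrongMonad T) (X : SetSMC)
  : Hom (ZSet M X) (T X) :=
  fun t => proj1_sig t.

Arguments ZSet {T} M X.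
Arguments ZSet_incl {T} M X.

(* Main.v *)
Require Import Defs.
From Stdlib Require Import FunctionalExtensionality ProofIrrelevance.

(** A Kleisli map [f : X -> T Y] of a strong monad on sets is central exactly
    when it takes values in [ZSet M Y].  Since central maps contain the identities
    and are closed under Kleisli composition, and since every operation of [T] is
    a Kleisli composite of pure maps and of inclusions [ZSet M X -> T X], the
    operations of [T] restrict to [ZSet M].  The monad laws follow because the
    inclusions are componentwise monic, commutativity is the membership condition
    of [ZSet M], and the isomorphism of categories is the characterisation of
    central maps read in both directions. *)

Set Implicit Arguments.
Unset Strict Implicit.

(** * Equality of functors, and strong monads restricted along monic maps *)

Lemma Build_Functor_ext (C D : Category) (F : C -> D)
    (h h' : forall X Y : C, Hom X Y -> Hom (F X) (F Y)) hi hc hi' hc' :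
  (forall X Y f, h X Y f = h' X Y f) ->
  @Build_Functor C D F h hi hc = @Build_Functor C D F h' hi' hc'.
Proof.
intros e.
assert (E : h = h').
{ extensionality X; extensionality Y; extensionality f; apply e. }
subst h'; f_equal; apply proof_irrelevance.
Qed.

(** The compatibility equations push [j] past every operation, so each law for [S], postcomposed
    with the monic [j], reduces to the same law for [T]. *)
Lemma corestricted_strong_monad (C : SymMonCat) (S T : C -> C)
    (M : StrongMonad T) (j : forall X : C, Hom (S X) (T X))
    (Sfmap : forall X Y : C, Hom X Y -> Hom (S X) (S Y))
    (Seta : forall X : C, Hom X (S X))
    (Smu : forall X : C, Hom (S (S X)) (S X))
    (Sstrength : forall X Y : C, Hom (X ⊗ S Y) (S (X ⊗ Y))) :
  (forall X, monomorphism (j X)) ->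
  (forall (X Y : C) (f : Hom X Y), j Y ∘ Sfmap X Y f = fmap M f ∘ j X) ->
  (forall X, j X ∘ Seta X = eta M X) ->
  (forall X, j X ∘ Smu X = mu M X ∘ fmap M (j X) ∘ j (S X)) ->
  (forall X Y, j (X ⊗ Y) ∘ Sstrength X Y = strength M X Y ∘ (idm X ⊠ j Y)) ->
  exists (MS : StrongMonad S) (i : StrongMonadMor MS M), forall X, i X = j X.
Proof.
intros jm jf je jmu js.
(* The [let] keeps [MS] transparent, so that the compatibility equations serve as the fields of the
   morphism. *)
unshelve (refine (let MS : StrongMonad S := _ in _)).
- refine {| fmap := Sfmap; eta := Seta; mu := Smu; strength := Sstrength |}.
  + intros X; apply jm; now rewrite jf, fmap_id, comp_idl, comp_idr.
  + intros X Y Z g f; apply jm.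
    now rewrite jf, fmap_comp, comp_assoc, jf, <- !comp_assoc, jf.
  + intros X Y f; apply jm.
    now rewrite !comp_assoc, je, jf, <- comp_assoc, je, eta_nat.
  + intros X Y f; apply jm.
    rewrite !comp_assoc, jmu, jf, <- !comp_assoc, jf, jmu.
    rewrite (comp_assoc (fmap M (j Y))), <- fmap_comp, jf, fmap_comp.
    now rewrite !comp_assoc, mu_nat.
  + intros X; apply jm.
    rewrite comp_assoc, jmu, <- comp_assoc, je, <- comp_assoc, <- eta_nat.
    now rewrite comp_assoc, mu_eta, comp_idl, comp_idr.
  + intros X; apply jm.
    rewrite comp_assoc, jmu, <- comp_assoc, jf.
    rewrite <- comp_assoc, (comp_assoc (fmap M (j X))), <- fmap_comp, je.
    now rewrite comp_assoc, mu_fmap_eta, comp_idl, comp_idr.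
  + intros X; apply jm.
    rewrite !comp_assoc, jmu, <- !comp_assoc, jf, jmu.
    rewrite (comp_assoc (fmap M (j X)) (fmap M (Smu X))), <- fmap_comp, jmu.
    rewrite !fmap_comp, !comp_assoc, <- mu_mu.
    now rewrite <- (comp_assoc (mu M X) (mu M (T X))), mu_nat, !comp_assoc.
  + intros X X' Y Y' f g; apply jm.
    rewrite !comp_assoc, js, jf, <- !comp_assoc, js.
    rewrite (comp_assoc (fmap M (f ⊠ g))), <- strength_nat, <- comp_assoc.
    now rewrite <- !tens1_comp, jf, comp_idl, comp_idr.
  + intros X; apply jm.
    rewrite comp_assoc, jf, <- comp_assoc, js, comp_assoc, strength_lunit.
    apply lunit_nat.
  + intros X Y Z; apply jm.
    rewrite !comp_assoc, jf, js, <- !comp_assoc, js.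
    rewrite (comp_assoc (fmap M (assoc X Y Z))), strength_assoc.
    rewrite (comp_assoc (idm X ⊠ j _)), <- tens1_comp, js, <- !comp_assoc.
    rewrite <- tens1_id, assoc_nat, (comp_assoc (idm X ⊠ strength M Y Z)).
    now rewrite <- tens1_comp.
  + intros X Y; apply jm.
    rewrite comp_assoc, js, <- comp_assoc, <- tens1_comp, je, comp_idl.
    now rewrite strength_eta, je.
  + intros X Y; apply jm.
    rewrite !comp_assoc, js, jmu, <- !comp_assoc, <- tens1_comp, jmu.
    rewrite (comp_assoc (j (S (X ⊗ Y)))), jf.
    rewrite <- (comp_assoc (fmap M (Sstrength X Y))), js.
    rewrite comp_idl, (comp_assoc (fmap M (j (X ⊗ Y)))), <- fmap_comp, js.
    (* Splitting the tensor exposes one factor for [strength_mu] and one for [strength_nat]. *)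
    assert (e : idm X ⊠ (mu M Y ∘ fmap M (j Y) ∘ j (S Y))
                = (idm X ⊠ mu M Y) ∘ (idm X ⊠ fmap M (j Y)) ∘ (idm X ⊠ j (S Y)))
      by now rewrite <- !tens1_comp, !comp_idl.
    rewrite e, !comp_assoc, strength_mu, <- !comp_assoc.
    rewrite (comp_assoc (strength M X (T Y))), strength_nat, fmap_comp.
    now rewrite !comp_assoc.
- exists MS.
  now exists (Build_StrongMonadMor (MS := MS) (MT := M) jf je jmu js).
Qed.

Lemma componentwise_mono_submonad (C : SymMonCat) (S T : C -> C)
    (MS : StrongMonad S) (M : StrongMonad T) (i : StrongMonadMor MS M) :
  (forall X, monomorphism (i X)) -> is_submonad i.
Proof.
intros im W f g e; apply smm_ext; intros X; apply im.
exact (f_equal (fun a : StrongMonadMor (projT2 W) M => a X) e).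
Qed.

(** * Strong monad morphisms and the two double strengths *)

Section Morphism.
Variables (C : SymMonCat) (S T : C -> C) (MS : StrongMonad S) (M : StrongMonad T).
Variable i : StrongMonadMor MS M.

Lemma smm_rstrength (X Y : C) :
  i (X ⊗ Y) ∘ rstrength MS X Y = rstrength M X Y ∘ (i X ⊠ idm Y).
Proof.
unfold rstrength.
rewrite !comp_assoc, smm_nat, <- !comp_assoc, braid_nat.
now rewrite (comp_assoc (i (Y ⊗ X))), smm_strength, <- comp_assoc.
Qed.

(** With [smm_rl_strength], this reduces commutativity of [MS], for monic [i], to an equation in [M]
    precomposed with [i X ⊠ i Y]. *)
Lemma smm_lr_strength (X Y : C) :
  i (X ⊗ Y) ∘ (mu MS (X ⊗ Y) ∘ fmap MS (rstrength MS X Y) ∘ strength MS (S X) Y)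
  = mu M (X ⊗ Y) ∘ fmap M (rstrength M X Y) ∘ strength M (T X) Y ∘ (i X ⊠ i Y).
Proof.
rewrite !comp_assoc, smm_mu, <- !comp_assoc.
rewrite (comp_assoc (i (S (X ⊗ Y)))), smm_nat, <- comp_assoc, smm_strength.
rewrite (comp_assoc (fmap M (i (X ⊗ Y)))), <- fmap_comp, smm_rstrength, fmap_comp.
rewrite <- comp_assoc, (comp_assoc (fmap M (i X ⊠ idm Y))), <- strength_nat.
now rewrite <- comp_assoc, <- tens1_comp, fmap_id, comp_idl, comp_idr.
Qed.

Lemma smm_rl_strength (X Y : C) :
  i (X ⊗ Y) ∘ (mu MS (X ⊗ Y) ∘ fmap MS (strength MS X Y) ∘ rstrength MS X (S Y))
  = mu M (X ⊗ Y) ∘ fmap M (strength M X Y) ∘ rstrength M X (T Y) ∘ (i X ⊠ i Y).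
Proof.
rewrite !comp_assoc, smm_mu, <- !comp_assoc.
rewrite (comp_assoc (i (S (X ⊗ Y)))), smm_nat, <- comp_assoc, smm_rstrength.
rewrite (comp_assoc (fmap M (i (X ⊗ Y)))), <- fmap_comp, smm_strength, fmap_comp.
rewrite <- comp_assoc; do 2 f_equal.
(* What remains contains naturality of the right strength in its second argument; the braiding turns
   it into naturality of [strength] in its first. *)
unfold rstrength.
rewrite <- !comp_assoc, !braid_nat, (comp_assoc (fmap M (idm X ⊠ i Y))).
rewrite <- fmap_comp, <- braid_nat, fmap_comp, <- comp_assoc.
rewrite (comp_assoc (fmap M (i Y ⊠ idm X))), <- strength_nat, <- comp_assoc.
now rewrite (comp_assoc (i Y ⊠ _)), <- tens1_comp, fmap_id, comp_idl, comp_idr.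
Qed.

End Morphism.

(** * Central elements of a strong monad on sets *)

Section CentreOnSets.
Variables (T : SetSMC -> SetSMC) (M : StrongMonad T).

(** The predicate carving out [ZSet M X], so its proofs are directly the second components of
    elements of [ZSet M X]. *)
Definition central_element (X : SetSMC) (t : T X) : Prop :=
  forall (Y : SetSMC) (s : T Y),
    mu M (X ⊗ Y) (fmap M (rstrength M X Y) (strength M (T X) Y (t, s)))
    = mu M (X ⊗ Y) (fmap M (strength M X Y) (rstrength M X (T Y) (t, s))).

(** By naturality of the strengths, both sides of the centrality equation at [(x, x')] depend only
    on the values [f x] and [f' x']. *)
Lemma central_pointwise (X Y : SetSMC) (f : Hom X (T Y)) :
  central M f <-> forall x : X, central_element (f x).
Proof.
assert (L : forall (X' Y' : SetSMC) (f' : Hom X' (T Y')) (x : X) (x' : X'),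
  kcomp M (kwhiskl M f Y') (kwhiskr M X f') (x, x')
  = mu M _ (fmap M (rstrength M Y Y') (strength M (T Y) Y' (f x, f' x')))).
{ intros X' Y' f' x x'; unfold kcomp, kwhiskl, kwhiskr; rewrite fmap_comp.
  pose proof (f_equal (fun h => h (x, f' x'))
    (strength_nat M f (idm Y'))) as N.
  rewrite fmap_id in N; simpl in *; now rewrite N. }
assert (R : forall (X' Y' : SetSMC) (f' : Hom X' (T Y')) (x : X) (x' : X'),
  kcomp M (kwhiskr M Y f') (kwhiskl M f X') (x, x')
  = mu M _ (fmap M (strength M Y Y') (rstrength M Y (T Y') (f x, f' x')))).
{ intros X' Y' f' x x'; unfold kcomp, kwhiskl, kwhiskr; rewrite fmap_comp.
  pose proof (f_equal (fun h => h (x', f x))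
    (strength_nat M f' (idm Y))) as N.
  (* The two composites under [fmap M] are convertible: naturality of the braiding on sets holds by
     computation. *)
  assert (B := f_equal (fun h => h (strength M X' Y (x', f x)))
    (eq_trans (eq_sym (fmap_comp M (idm Y ⊠ f') (braid X' Y)))
              (fmap_comp M (braid (T Y') Y) (f' ⊠ idm Y)))).
  rewrite fmap_id in N; unfold rstrength; simpl in *; now rewrite N, B. }
split.
- intros cf x Y' s.
  (* The identity of [T Y'], read as a Kleisli map from [T Y'] to [Y'], takes every [s] as a
     value. *)
  pose proof (f_equal (fun h => h (x, s)) (cf _ _ (idm (T Y')))) as E.
  simpl in E; now rewrite L, R in E.
- intros cf X' Y' f'; extensionality p; destruct p as [x x'].
  rewrite L, R; apply cf.
Qed.

(** Elements become Kleisli maps out of [munit], so closure properties of central maps transfer to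
    them. *)
Lemma central_element_const (X : SetSMC) (t : T X) :
  central_element t <-> central M ((fun _ => t) : Hom (munit : SetSMC) (T X)).
Proof.
split; intros ct.
- apply central_pointwise; intros _; exact ct.
- exact (proj1 (central_pointwise _) ct tt).
Qed.

Lemma central_element_eta (X : SetSMC) (x : X) : central_element (eta M X x).
Proof. exact (proj1 (central_pointwise (eta M X)) (central_eta M X) x). Qed.

(** This element is the value of the Kleisli composite of [f] with the constant map at [t]. *)
Lemma central_element_bind (X Y : SetSMC) (f : Hom X (T Y)) (t : T X) :
  (forall x, central_element (f x)) -> central_element t ->
  central_element (mu M Y (fmap M f t)).
Proof.
intros cf ct; apply central_element_const.
apply central_pointwise in cf; apply central_element_const in ct.
exact (central_comp cf ct).
Qed.

Lemma fmap_bind (X Y : SetSMC) (f : Hom X Y) (t : T X) :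
  fmap M f t = mu M Y (fmap M (eta M Y ∘ f) t).
Proof.
rewrite fmap_comp; symmetry.
exact (f_equal (fun h => h (fmap M f t)) (mu_fmap_eta M Y)).
Qed.

Lemma central_element_fmap (X Y : SetSMC) (f : Hom X Y) (t : T X) :
  central_element t -> central_element (fmap M f t).
Proof.
intros ct; rewrite fmap_bind; apply central_element_bind; trivial.
intros x; apply central_element_eta.
Qed.

(* On sets the strength is determined by the functor: by naturality it is
   enough to know it at [munit], where the unit law fixes it. *)
Lemma strength_set (X Y : SetSMC) (x : X) (t : T Y) :
  strength M X Y (x, t) = fmap M ((fun y => (x, y)) : Hom Y (X ⊗ Y)) t.
Proof.
set (c := (fun _ => x) : Hom (munit : SetSMC) X).
pose proof (f_equal (fun h => h (tt, t)) (strength_nat M c (idm Y))) as N.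
rewrite fmap_id in N.
pose proof (f_equal (fun h => h (tt, t)) (strength_lunit M Y)) as U.
set (px := (fun y => (x, y)) : Hom Y (X ⊗ Y)).
etransitivity; [exact N | etransitivity; [|exact (f_equal (fmap M px) U)]].
exact (f_equal (fun h => h (strength M munit Y (tt, t)))
  (fmap_comp M px (lunit Y))).
Qed.

Lemma central_element_strength (X Y : SetSMC) (x : X) (t : T Y) :
  central_element t -> central_element (strength M X Y (x, t)).
Proof. intros ct; rewrite strength_set; now apply central_element_fmap. Qed.

Lemma ZSet_incl_mono (X : SetSMC) : monomorphism (ZSet_incl M X).
Proof.
intros W f g e; extensionality w.
apply eq_sig_hprop; [intros; apply proof_irrelevance|].
exact (f_equal (fun h => h w) e).
Qed.

Lemma central_submonad :
  exists (MZ : StrongMonad (ZSet M)) (i : StrongMonadMor MZ M),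
    forall X, i X = ZSet_incl M X.
Proof.
apply (@corestricted_strong_monad SetSMC (ZSet M) T M (ZSet_incl M)
  (fun X Y f t => exist _ (fmap M f (proj1_sig t))
     (central_element_fmap f (proj2_sig t)))
  (fun X x => exist _ (eta M X x) (central_element_eta x))
  (* Compatibility of [mu] with the inclusion forces this choice; it is a bind along a map with
     central values. *)
  (fun X t => exist _ (mu M X (fmap M (ZSet_incl M X) (proj1_sig t)))
     (central_element_bind (f := ZSet_incl M X)
        (fun z => proj2_sig z) (proj2_sig t)))
  (fun X Y p => exist _ (strength M X Y (fst p, proj1_sig (snd p)))
     (central_element_strength (fst p) (proj2_sig (snd p)))));
(* The compatibility equations hold by computation; only monicity is left. *)
try reflexivity.
exact ZSet_incl_mono.
Qed.

(** * Commutativity, and the Kleisli embedding onto the premonoidal centre *)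

Section Embedding.
Variables (MZ : StrongMonad (ZSet M)) (i : StrongMonadMor MZ M).
Hypothesis iE : forall X, i X = ZSet_incl M X.

(** Inside [T], the required equation at a pair is the centrality of its first component tested
    against the second. *)
Lemma central_submonad_commutative : commutative MZ.
Proof.
intros X Y; apply ZSet_incl_mono; rewrite <- (iE (X ⊗ Y)).
rewrite smm_lr_strength, smm_rl_strength, !iE.
extensionality p; destruct p as [[t ct] [s cs]]; exact (ct Y s).
Qed.

Lemma central_embedding (X Y : SetSMC) (f : Hom X (ZSet M Y)) : central M (i Y ∘ f).
Proof.
rewrite iE; apply central_pointwise; intros x; exact (proj2_sig (f x)).
Qed.

Definition embedding_corestriction : Functor (Kleisli MZ) (premonoidal_centre M).
Proof.
refine (@Build_Functor (Kleisli MZ) (premonoidal_centre M) (fun X => X)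
  (fun X Y f => exist _ (i Y ∘ f) (central_embedding f)) _ _).
- intros X; apply subset_eq_compat; exact (fhom_id (kleisli_embedding i) X).
- intros X Y Z g f; apply subset_eq_compat.
  exact (fhom_comp (kleisli_embedding i) g f).
Defined.

Definition central_lift (X Y : SetSMC) (f : {f : Hom X (T Y) | central M f})
  : Hom X (ZSet M Y) :=
  fun x => exist _ (proj1_sig f x)
             (proj1 (central_pointwise (proj1_sig f)) (proj2_sig f) x).

Lemma central_liftK (X Y : SetSMC) (f : {f : Hom X (T Y) | central M f}) :
  i Y ∘ central_lift f = proj1_sig f.
Proof. rewrite iE; reflexivity. Qed.

(** Functoriality is checked after the monic inclusion, where lifting is undone by
    [central_liftK]. *)
Definition central_lift_functor : Functor (premonoidal_centre M) (Kleisli MZ).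
Proof.
refine (@Build_Functor (premonoidal_centre M) (Kleisli MZ) (fun X => X)
  central_lift _ _).
- intros X; apply ZSet_incl_mono; rewrite <- (iE X).
  rewrite central_liftK; symmetry; apply smm_eta.
- intros X Y Z g f; apply ZSet_incl_mono; rewrite <- (iE Z), central_liftK.
  etransitivity; [|symmetry; exact (fhom_comp (kleisli_embedding i)
    (central_lift g) (central_lift f))].
  change (kcomp M (proj1_sig g) (proj1_sig f)
    = kcomp M (i Z ∘ central_lift g) (i Y ∘ central_lift f)).
  now rewrite !central_liftK.
Defined.

(** Both functors fix objects, so strict equality of the composites with the identities only
    concerns morphisms. *)
Lemma embedding_corestriction_iso : category_isomorphism embedding_corestriction.
Proof.
exists central_lift_functor; split.
- apply Build_Functor_ext.
  intros X Y f; apply ZSet_incl_mono; rewrite <- (iE Y).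
  exact (central_liftK _).
- apply Build_Functor_ext.
  intros X Y [f cf]; apply subset_eq_compat; exact (central_liftK (exist _ f cf)).
Qed.

Lemma embedding_corestrictionE :
  functor_comp (centre_inclusion M) embedding_corestriction = kleisli_embedding i.
Proof.
apply Build_Functor_ext.
reflexivity.
Qed.

End Embedding.
End CentreOnSets.

Theorem theorem2p2 (T : SetSMC -> SetSMC) (M : StrongMonad T) :
  exists (MZ : StrongMonad (ZSet M)) (i : StrongMonadMor MZ M),
    (forall X : SetSMC, i X = ZSet_incl M X) /\
    is_submonad i /\
    commutative MZ /\
    exists J : Functor (Kleisli MZ) (premonoidal_centre M),
      functor_comp (centre_inclusion M) J = kleisli_embedding i /\
      category_isomorphism J.
Proof.
destruct (central_submonad M) as [MZ [i iE]].
exists MZ, i; split; [exact iE | split; [|split]].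
- apply componentwise_mono_submonad; intros X; rewrite iE; apply ZSet_incl_mono.
- exact (central_submonad_commutative iE).
- exists (embedding_corestriction iE); split.
  + apply embedding_corestrictionE.
  + apply embedding_corestriction_iso.
Qed.
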